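(* Let $(X,r)$ be a finite left non-degenerate idempotent set-theoretic solution of the Yang--Baxter equation and let $K$ be a field. Then the (disjoint) union $G^e:=\bigcup_{u\in\Lambda}G_u$ is a left cancellative simple semigroup for the binary operation $\circ$ defined as \[((a,\lambda_a)\circ c_u^n)\circ((b,\lambda_b)\circ c_v^m)=(a+\lambda_a(b),\lambda_{a+\lambda_a(b)})\circ c_v^{n+m}\] for $u,v\in\Lambda$, $(a,\lambda_a)\in S_u$, $(b,\lambda_b)\in S_v$ and $n,m\in\mathbb{Z}$. Moreover, $S=S(X,r)$ is the subsemigroup of \[G^e=\bigcup_{u\in\Lambda}G_u=\bigcup_{u\in\Lambda}(T(G_u)\rtimes_{\sigma_u}\mathrm{gr}((x_u,\lambda_{x_u})))=\bigcup_{u\in\Lambda}(T(G_u)\rtimes_{\sigma_u}\mathbb{Z})\cong\mathcal{M}(G_u,1,|\Lambda|,J)\] generated by the elements $t\circ(x_u,\lambda_{x_u})$, with $t\in T(G_u)$ and $u\in\Lambda$ (in the last isomorphism $u\in\Lambda$ is arbitrary). Furthermore, for each $u\in\Lambda$, \[T(G_u)=\{(x,\lambda_x)\circ(x_u,\lambda_{x_u})^{-1}:x\in X\text{ with }q(x)=u\}.\] In particular, the algebra $K[S(X,r)]$ is a subalgebra of the $\Lambda$-graded ring \[\bigoplus_{u\in\Lambda}K[G_u]=\bigoplus_{u\in\Lambda}K[T(G_u)][t_u^{\pm1};\sigma_u],\] where each summand is a skew Laurent polynomial algebra over the group algebra $K[T(G_u)]$ of the finite group $T(G_u)$.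
   Context: A set-theoretic solution of the Yang--Baxter equation is a pair $(X,r)$ with $X$ a non-empty set and $r\colon X\times X\to X\times X$ a map satisfying $(r\times\mathrm{id})(\mathrm{id}\times r)(r\times\mathrm{id})=(\mathrm{id}\times r)(r\times\mathrm{id})(\mathrm{id}\times r)$. Write $r(x,y)=(\lambda_x(y),\rho_y(x))$. It is finite if $X$ is finite, left non-degenerate if every $\lambda_x\colon X\to X$ is bijective, and idempotent if $r^2=r$. The diagonal map is $q\colon X\to X$, $q(x)=\lambda_x^{-1}(x)$, and $\Lambda=q(X)$. The structure monoid is $M=M(X,r)=\langle X\mid x\circ y=\lambda_x(y)\circ\rho_y(x),\ x,y\in X\rangle$ and the structure semigroup is $S=S(X,r)=M\setminus\{1\}$; $K[S]$ is its semigroup algebra over $K$. For $(X,r)$ left non-degenerate and idempotent, the derived structure monoid is $A=A(X,r)=\langle X\mid x+y=y+y,\ x,y\in X\rangle$ (written additively); every non-zero element is uniquely of the form $nx$ with $n\ge1$, $x\in X$, one has $nx+my=(n+m)y$ for $m\ge1$, and its length is $|nx|=n$. Each $\lambda_x$ extends to an automorphism of $A$, and this yields a monoid homomorphism $\lambda\colon(M,\circ)\to\mathrm{Aut}(A,+)$, $m\mapsto\lambda_m$. There is a bijection $\pi\colon M\to A$ with $\pi(x)=x$ for $x\in X$ and $\pi(m\circ m')=\pi(m)+\lambda_m(\pi(m'))$. For $a\in A$ write $\lambda_a=\lambda_{\pi^{-1}(a)}$. Identify $m\in M$ with $(\pi(m),\lambda_m)\in A\rtimes\mathrm{Aut}(A,+)$;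 thus $M=\{(a,\lambda_a):a\in A\}$, the generator $x\in X$ is $(x,\lambda_x)$, and $(a,\lambda_a)\circ(b,\lambda_b)=(a+\lambda_a(b),\lambda_a\lambda_b)$ with $\lambda_{a+\lambda_a(b)}=\lambda_a\lambda_b$. For $u\in\Lambda$, $S_u=\{(a,\lambda_a)\in S:\lambda_a^{-1}(a)=|a|u\}$; these are cancellative subsemigroups, $S$ is their disjoint union and $S_u\circ S_v\subseteq S_v$. The symbol $d$ denotes a fixed positive multiple of the exponent of the permutation group $\mathrm{gr}(\lambda_x:x\in X)\subseteq\mathrm{Sym}(X)$. The element $c_u=(du,\mathrm{id})$ lies in $S_u$, is central in $S_u$, and inverting it yields the group of quotients $G_u=S_u\circ\langle c_u\rangle^{-1}$ of $S_u$, so every element of $G_u$ has the form $(a,\lambda_a)\circ c_u^n$ with $(a,\lambda_a)\in S_u$, $n\in\mathbb{Z}$. The elements of finite order of $G_u$ form a finite subgroup $T(G_u)$, and $G_u/T(G_u)\cong\mathbb{Z}$. For each $u\in\Lambda$ fix $x_u\in X$ with $(x_u,\lambda_{x_u})\in S_u$ (equivalently $q(x_u)=u$) whose coset generates $G_u/T(G_u)$; then $G_u=T(G_u)\rtimes_{\sigma_u}\mathrm{gr}((x_u,\lambda_{x_u}))$, where $\mathrm{gr}$ denotes the generated subgroup and $\sigma_u$ is conjugation by $(x_u,\lambda_{x_u})$. The groups $G_u$, $u\in\Lambda$, are regarded as pairwise disjoint. A semigroup is simple if it has no proper non-empty two-sided ideals. For a group $G$ and positive integer $m$, $\mathcal{M}(G,1,m,J)$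 is the semigroup of triples $(g,1,j)$, $g\in G$, $1\le j\le m$, with multiplication $(g,1,j)(h,1,l)=(gh,1,l)$. The ring $\bigoplus_{u\in\Lambda}K[G_u]$ has the multiplication obtained by $K$-linearly extending the operation $\circ$ of $G^e$, and it is graded by the band $\Lambda$ with $uv=v$. *)

(* Defs.v *)
From HB Require Import structures.
From mathcomp Require Import all_boot all_order all_algebra all_fingroup all_solvable.
From mathcomp Require Import finmap boolp.
From mathcomp.multinomials Require Import monalg.

From mathcomp Require Import zify.

Set Implicit Arguments.
Unset Strict Implicit.
Unset Printing Implicit Defensive.

Local Open Scope quotient_scope.
Local Open Scope group_scope.

Local Notation qrepr := generic_quotient.repr.

Section Presentation.
Variables (X : choiceType) (R : seq X -> seq X -> Prop).

Inductive mcong : seq X -> seq X -> Prop :=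
| mcong_refl w : mcong w w
| mcong_sym v w : mcong v w -> mcong w v
| mcong_trans u v w : mcong u v -> mcong v w -> mcong u w
| mcong_step s t v w : R v w -> mcong (s ++ v ++ t) (s ++ w ++ t).

Definition mcongb (v w : seq X) : bool := `[< mcong v w >].

Lemma mcongb_equiv : equiv_class_of mcongb.
Proof.
split.
- by move=> w; apply/asboolP/mcong_refl.
- by move=> v w; apply/asboolP/asboolP => /mcong_sym.
- by move=> v u w /asboolP h1 /asboolP h2; apply/asboolP/(mcong_trans h1).
Qed.

Canonical mcongb_equiv_rel := EquivRelPack mcongb_equiv.

Definition presented := {eq_quot mcongb}.
HB.instance Definition _ := Choice.on presented.
HB.instance Definition _ := EqQuotient.on presented.

Definition mcl (w : seq X) : presented := \pi_presented w.

Lemma mclP v w : mcl v = mcl w <-> mcong v w.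
Proof.
by split => [/eqP|h]; [rewrite piE => /asboolP | apply/eqP; rewrite piE; apply/asboolP].
Qed.

Lemma mcong_repr w : mcong (qrepr (mcl w)) w.
Proof. by apply/mclP; rewrite /mcl reprK. Qed.

Lemma mclK (m : presented) : mcl (qrepr m) = m.
Proof. exact: reprK. Qed.

Lemma mcong_cat v v' w w' : mcong v v' -> mcong w w' -> mcong (v ++ w) (v' ++ w').
Proof.
move=> hv hw; apply: (@mcong_trans _ (v' ++ w)).
- elim: hv => {v v'} [v|v v' _ IH|u v v' _ IH1 _ IH2|s t v v' r].
  + exact: mcong_refl. + exact: mcong_sym. + exact: mcong_trans IH2.
  + by rewrite -!catA; apply: mcong_step.
- elim: hw => {w w'} [w|w w' _ IH|u w w' _ IH1 _ IH2|s t w w' r].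
  + exact: mcong_refl. + exact: mcong_sym. + exact: mcong_trans IH2.
  + by rewrite !(catA v' s); apply: mcong_step.
Qed.

Definition pmul (m n : presented) : presented := mcl (qrepr m ++ qrepr n).
Definition pone : presented := mcl [::].

Lemma pmul_cl v w : pmul (mcl v) (mcl w) = mcl (v ++ w).
Proof. by apply/mclP/mcong_cat; apply: mcong_repr. Qed.

Lemma pmulA : associative pmul.
Proof.
move=> a b c; rewrite -(mclK a) -(mclK b) -(mclK c).
by rewrite !pmul_cl catA.
Qed.
Lemma pmul1 : left_id pone pmul.
Proof. by move=> a; rewrite -(mclK a) /pone pmul_cl. Qed.
Lemma pmulr1 : right_id pone pmul.
Proof. by move=> a; rewrite -(mclK a) /pone pmul_cl cats0. Qed.

HB.instance Definition _ := isMonoid.Build presented pmulA pmul1 pmulr1.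

Lemma mclM v w : mcl v * mcl w = mcl (v ++ w).
Proof. exact: pmul_cl. Qed.
Lemma mcl1 : mcl [::] = 1. Proof. by []. Qed.

End Presentation.
Arguments mcl {X R} w.

Definition torsion (G : groupType) : pred G :=
  [pred g | `[< exists2 n : nat, 0 < n & g ^+ n = 1 >]].
Arguments torsion G : clear implicits.

Definition zexpg (G : groupType) (g : G) (n : int) : G :=
  match n with Posz k => g ^+ k | Negz k => g ^- k.+1 end.

Section Braid.
Variable X : Type.
Implicit Types (r : X * X -> X * X) (t : X * X * X).
Definition map12 r t : X * X * X := (r t.1, t.2).
Definition map23 r t : X * X * X :=
  let z := r (t.1.2, t.2) in (t.1.1, z.1, z.2).
Definition ybe r : Prop :=
  forall t, map12 r (map23 r (map12 r t)) = map23 r (map12 r (map23 r t)).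
Definition lam r (x y : X) : X := (r (x, y)).1.
Definition rho r (y x : X) : X := (r (x, y)).2.
End Braid.

Record solution (X : finType) := Solution {
  sol_map :> X * X -> X * X;
  sol_nonempty : 0 < #|X|;
  sol_ybe : ybe sol_map;
  sol_left_nondegenerate : forall x, bijective (lam sol_map x);
  sol_idempotent : forall p, sol_map (sol_map p) = sol_map p }.

(* The derived monoid A does not depend on r; it is written multiplicatively,
   so that [gA x ^+ n] is the element [nx].                                 *)
Inductive derived_rel (X : Type) : seq X -> seq X -> Prop :=
  DerivedRel x y : derived_rel [:: x; y] [:: y; y].

Inductive structure_rel (X : Type) (r : X * X -> X * X) : seq X -> seq X -> Prop :=
  StructureRel x y : structure_rel r [:: x; y] [:: lam r x y; rho r y x].

Definition derivedM (X : finType) : monoidType := presented (@derived_rel X).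
Definition structM (X : finType) (r : solution X) : monoidType := presented (structure_rel r).

Definition gA (X : finType) (x : X) : derivedM X := mcl [:: x].
Definition gM (X : finType) (r : solution X) (x : X) : structM r := mcl [:: x].

Section DerivedMonoid.
Variable X : finType.
Implicit Types (a b : derivedM X) (p : {perm X}).

Definition lenA a : nat := size (qrepr a).
(* Extension of a permutation of X to an automorphism of A. *)
Definition actA p a : derivedM X := mcl (map p (qrepr a)).

Lemma mcong_derived_size (v w : seq X) : mcong (@derived_rel X) v w -> size v = size w.
Proof.
elim=> {v w} [//|v w _ -> //|u v w _ -> _ -> //|s t v w [x y]].
by rewrite !size_cat.
Qed.

Lemma lenA_cl w : lenA (mcl w) = size w.
Proof. exact/mcong_derived_size/mcong_repr. Qed.

Lemma lenAM a b : lenA (a * b) = (lenA a + lenA b)%N.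
Proof. by rewrite -(mclK a) -(mclK b) mclM !lenA_cl size_cat. Qed.

Lemma lenA1 : lenA 1 = 0%N. Proof. by rewrite -mcl1 lenA_cl. Qed.

Lemma lenAX a n : lenA (a ^+ n) = (n * lenA a)%N.
Proof. by elim: n => [|n IH]; rewrite ?lenA1 // expgS lenAM IH. Qed.

Lemma lenA_g x : lenA (gA x) = 1%N. Proof. exact: lenA_cl. Qed.

Lemma lenA_eq0 a : lenA a = 0%N -> a = 1.
Proof. by rewrite -(mclK a) lenA_cl => /size0nil ->. Qed.

Lemma mcong_derived_map p (v w : seq X) : mcong (@derived_rel X) v w ->
  mcong (@derived_rel X) (map p v) (map p w).
Proof.
elim=> {v w} [w|v w _ IH|u v w _ IH1 _ IH2|s t v w [x y]].
- exact: mcong_refl.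
- exact: mcong_sym.
- exact: mcong_trans IH2.
- by rewrite !map_cat; apply/mcong_step/DerivedRel.
Qed.

Lemma actA_cl p w : actA p (mcl w) = mcl (map p w).
Proof. exact/mclP/mcong_derived_map/mcong_repr. Qed.

Lemma actAM p a b : actA p (a * b) = actA p a * actA p b.
Proof. by rewrite -(mclK a) -(mclK b) mclM !actA_cl map_cat mclM. Qed.

Lemma actA1 p : actA p 1 = 1. Proof. by rewrite -mcl1 actA_cl. Qed.

Lemma actAX p a n : actA p (a ^+ n) = actA p a ^+ n.
Proof. by elim: n => [|n IH]; rewrite ?actA1 // !expgS actAM IH. Qed.

Lemma actA_g p x : actA p (gA x) = gA (p x). Proof. exact: actA_cl. Qed.

Lemma actA_comp p1 p2 a : actA (p1 * p2) a = actA p2 (actA p1 a).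
Proof.
by rewrite -(mclK a) !actA_cl -map_comp; congr mcl; apply: eq_map => x /=; rewrite permM.
Qed.

Lemma actA_id a : actA 1 a = a.
Proof. by rewrite -{2}(mclK a) /actA map_id_in // => x _; rewrite perm1. Qed.

Lemma actAK p : cancel (actA p) (actA p^-1).
Proof. by move=> a; rewrite -actA_comp mulgV actA_id. Qed.
Lemma actAKV p : cancel (actA p^-1) (actA p).
Proof. by move=> a; rewrite -actA_comp mulVg actA_id. Qed.

Lemma lenA_act p a : lenA (actA p a) = lenA a.
Proof. by rewrite -(mclK a) actA_cl !lenA_cl size_map. Qed.

Lemma derivedE x y : gA x * gA y = gA y * gA y :> derivedM X.
Proof. by rewrite !mclM; apply/mclP; apply: (mcong_step [::] [::] (DerivedRel x y)). Qed.

Lemma mulA_gX a y n : a * gA y ^+ n.+1 = gA y ^+ (lenA a + n.+1).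
Proof.
rewrite -(mclK a) lenA_cl; elim: (qrepr a) => [|x w IH]; first by rewrite mcl1 mul1g.
rewrite -cat1s -mclM -mulgA IH -/(gA x) addnS expgS mulgA derivedE -mulgA -!expgS.
by rewrite /= addSn addnS.
Qed.

End DerivedMonoid.

Section StructureMonoid.
Variables (X : finType) (r : solution X).
Implicit Types (m n : structM r) (x y : X).

Definition lamp x : {perm X} := perm (bij_inj (sol_left_nondegenerate r x)).

Lemma lampE x y : lamp x y = lam r x y. Proof. exact: permE. Qed.

(* In {perm X}, [(s * t) x = t (s x)], so [wlam] sends the word [x1 .. xn] to
   the composite lambda_x1 o .. o lambda_xn.                                *)
Fixpoint wlam (w : seq X) : {perm X} :=
  if w is x :: w' then wlam w' * lamp x else 1.
Fixpoint wpi (w : seq X) : seq X :=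
  if w is x :: w' then x :: map (lamp x) (wpi w') else [::].
Fixpoint wpinv (p : {perm X}) (w : seq X) : seq X :=
  if w is x :: w' then p^-1 x :: wpinv (lamp (p^-1 x) * p) w' else [::].

(* An element m of M is identified with the pair (pi m, lambda m), and an
   automorphism of A in the image of lambda with a permutation of X, acting
   through [actA]. The maps lambda : M -> Aut(A), pi : M -> A and pi^-1 : A -> M; by
   [lambda_cl], [pi_cl] and [piinv_cl] they do not depend on the
   representative.                                                          *)
Definition lambda m : {perm X} := wlam (qrepr m).
Definition pi m : derivedM X := mcl (wpi (qrepr m)).
Definition piinv (a : derivedM X) : structM r := mcl (wpinv 1 (qrepr a)).
Definition lenM m : nat := lenA (pi m).

Definition diag x : X := (lamp x)^-1 x.

Lemma rhoE x y : rho r y x = diag (lam r x y).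
Proof.
have := congr1 fst (sol_idempotent r (x, y)).
rewrite /diag /lam /rho; case: (r (x, y)) => a b /= h.
by apply: (@perm_inj _ (lamp a)); rewrite permKV lampE.
Qed.

Lemma lamp_rho x y : lamp (lam r x y) (rho r y x) = lam r x y.
Proof. by rewrite rhoE permKV. Qed.

Lemma lamp_rel x y : lamp (rho r y x) * lamp (lam r x y) = lamp y * lamp x.
Proof.
apply/permP => z; rewrite !permM !lampE.
by have := congr1 (fun t => t.1.1) (sol_ybe r (x, y, z)).
Qed.

Lemma wlam_cat v w : wlam (v ++ w) = wlam w * wlam v.
Proof. by elim: v => [|x v IH] /=; rewrite ?mulg1 // IH mulgA. Qed.

Lemma wpi_cat v w : wpi (v ++ w) = wpi v ++ map (wlam v) (wpi w).
Proof.
elim: v => [|x v IH] /=; first by rewrite map_id_in // => x _; rewrite perm1.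
rewrite IH map_cat -map_comp; congr (_ :: _ ++ _).
by apply: eq_map => y /=; rewrite permM.
Qed.

Lemma lambda_cl w : lambda (mcl w) = wlam w.
Proof.
apply: (_ : forall v, mcong (structure_rel r) v w -> wlam v = wlam w); last exact: mcong_repr.
move=> v; elim=> {v w} [//|//|u v w _ -> _ -> //|s t v w [x y]].
by rewrite !wlam_cat /= !mul1g lamp_rel.
Qed.

Lemma pi_cl w : pi (mcl w) = mcl (wpi w).
Proof.
apply: (_ : forall v, mcong (structure_rel r) v w ->
  mcl (wpi v) = mcl (wpi w) :> derivedM X); last exact: mcong_repr.
move=> v; elim=> {v w} [//|//|u v w _ -> _ -> //|s t v w [x y]].
rewrite !wpi_cat !map_cat -!mclM; congr (_ * (_ * _)); last first.
  by rewrite /= !mul1g lamp_rel.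
rewrite /= lamp_rho lampE.
have E a b : mcl [:: a; b] = gA a * gA b :> derivedM X by rewrite mclM.
by rewrite !E derivedE.
Qed.

Lemma lambda1 : lambda 1 = 1. Proof. by rewrite -mcl1 lambda_cl. Qed.
Lemma lambda_g x : lambda (gM r x) = lamp x.
Proof. by rewrite lambda_cl /= mul1g. Qed.
Lemma lambda_mul m n : lambda (m * n) = lambda n * lambda m.
Proof. by rewrite -(mclK m) -(mclK n) mclM !lambda_cl wlam_cat. Qed.
Lemma lambdaX m k : lambda (m ^+ k) = lambda m ^+ k.
Proof. by elim: k => [|k IH]; rewrite ?lambda1 // expgS lambda_mul IH -expgSr. Qed.

Lemma pi1 : pi 1 = 1. Proof. by rewrite -mcl1 pi_cl. Qed.
Lemma pi_g x : pi (gM r x) = gA x. Proof. by rewrite pi_cl. Qed.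
Lemma piM m n : pi (m * n) = pi m * actA (lambda m) (pi n).
Proof. by rewrite -(mclK m) -(mclK n) mclM !pi_cl lambda_cl wpi_cat actA_cl mclM. Qed.

Lemma wpinv_cat p v w :
  wpinv p (v ++ w) = wpinv p v ++ wpinv (wlam (wpinv p v) * p) w.
Proof. by elim: v p => [|x v IH] p /=; rewrite ?mul1g // IH !mulgA. Qed.

Lemma wpi_wpinv p w : wpi (wpinv p w) = map p^-1 w.
Proof.
elim: w p => //= x w IH p; rewrite IH -map_comp; congr (_ :: _).
by apply: eq_map => y /=; rewrite invMg permM permKV.
Qed.

Lemma wpinv_wpi p w : wpinv p (map p (wpi w)) = w.
Proof.
elim: w p => //= x w IH p; rewrite permK -map_comp -[in RHS](IH (lamp x * p)).
by congr (_ :: wpinv _ _); apply: eq_map => y /=; rewrite permM.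
Qed.

Lemma piinv_cl w : piinv (mcl w) = mcl (wpinv 1 w).
Proof.
apply: (_ : forall v, mcong (@derived_rel X) v w ->
  mcl (wpinv 1 v) = mcl (wpinv 1 w) :> structM r); last exact: mcong_repr.
move=> v; elim=> {v w} [//|//|u v w _ -> _ -> //|s t v w [x y]].
rewrite !wpinv_cat -!mclM; congr (_ * _); move: (wlam _ * 1) => p.
have E z : mcl (wpinv p [:: z; y]) = mcl [:: p^-1 y; diag (p^-1 y)] :> structM r.
  apply/mclP; apply: (@mcong_trans _ _ _ [:: p^-1 z; (lamp (p^-1 z))^-1 (p^-1 y)]).
    by rewrite /= invMg permM; apply: mcong_refl.
  have := @mcong_step _ (structure_rel r) [::] [::] _ _
    (StructureRel r (p^-1 z) ((lamp (p^-1 z))^-1 (p^-1 y))).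
  by rewrite rhoE -lampE permKV.
have EW z : wlam (wpinv p [:: z; y]) = wlam [:: p^-1 y; diag (p^-1 y)].
  by rewrite -!lambda_cl E.
by rewrite !EW !E.
Qed.

Lemma piinvK a : pi (piinv a) = a.
Proof. by rewrite pi_cl wpi_wpinv invg1 map_id_in ?mclK // => x; rewrite perm1. Qed.

Lemma piK m : piinv (pi m) = m.
Proof.
rewrite -(mclK m) pi_cl piinv_cl -{2}(wpinv_wpi 1 (qrepr m)) map_id_in // => x _.
by rewrite perm1.
Qed.

Lemma pi_inj : injective pi. Proof. exact: can_inj piK. Qed.

Lemma lenMM m n : lenM (m * n) = (lenM m + lenM n)%N.
Proof. by rewrite /lenM piM lenAM lenA_act. Qed.
Lemma lenM1 : lenM 1 = 0%N. Proof. by rewrite /lenM pi1 lenA1. Qed.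
Lemma lenM_g x : lenM (gM r x) = 1%N. Proof. by rewrite /lenM pi_g lenA_g. Qed.
Lemma lenM_eq0 m : (lenM m == 0%N) = (m == 1).
Proof.
apply/eqP/eqP => [/lenA_eq0 h|->]; last exact: lenM1.
by apply: pi_inj; rewrite pi1.
Qed.
Lemma lenMX m k : lenM (m ^+ k) = (k * lenM m)%N.
Proof. by elim: k => [|k IH]; rewrite ?lenM1 // expgS lenMM IH. Qed.

Definition in_S : pred (structM r) := [pred m | m != 1].
Lemma in_S_closed : mulg_closed in_S.
Proof. by move=> m n; rewrite !inE -!lenM_eq0 lenMM addn_eq0 => /negPf ->. Qed.
Definition structS := {m : structM r | in_S m}.
HB.instance Definition _ := SubChoice.on structS.
HB.instance Definition _ := SubChoice_isSubSemigroup.Build (structM r) in_S structS in_S_closed.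

Definition Lambda := {u : X | u \in codom diag}.
HB.instance Definition _ := SubFinite.on Lambda.

Definition in_Su (u : X) : pred (structM r) :=
  [pred m | (m != 1) && (actA (lambda m)^-1 (pi m) == gA u ^+ lenA (pi m))].

Lemma in_SuP u m : reflect (m != 1 /\ pi m = gA (lambda m u) ^+ lenM m) (in_Su u m).
Proof.
apply: (iffP andP) => -[h1 h2]; split=> //.
  by rewrite -(actAKV (lambda m) (pi m)) (eqP h2) actAX actA_g.
by rewrite /= {1}h2 actAX actA_g permK.
Qed.

Lemma Su_lenP u m : in_Su u m -> exists k, lenM m = k.+1.
Proof. by case/in_SuP; rewrite -lenM_eq0; case: lenM => // k; exists k. Qed.

Lemma in_Su_mull u m n : in_Su u n -> in_Su u (m * n).
Proof.
move=> h; have [k hk] := Su_lenP h; case/in_SuP: h => h1 h2; apply/in_SuP; split.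
  by rewrite -lenM_eq0 lenMM hk addnS.
by rewrite piM h2 actAX actA_g lambda_mul permM lenMM hk mulA_gX.
Qed.

Lemma in_Su_g x : in_Su (diag x) (gM r x).
Proof.
apply/in_SuP; split; first by rewrite -lenM_eq0 lenM_g.
by rewrite lenM_g pi_g lambda_g permKV.
Qed.

Definition Su (u : Lambda) := {m : structM r | in_Su (val u) m}.
Lemma in_Su_closed u : mulg_closed (in_Su u).
Proof. by move=> m n _; apply: in_Su_mull. Qed.
HB.instance Definition _ u := SubChoice.on (Su u).
HB.instance Definition _ (u : Lambda) :=
  SubChoice_isSubSemigroup.Build (structM r) (in_Su (val u)) (Su u) (@in_Su_closed (val u)).

(* The product S_u x S_v -> S_v induced by the product of M. By [piM] and
   [lambda_mul] it is (a + lambda_a(b), lambda_a lambda_b).                 *)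
Definition Smul u v (a : Su u) (b : Su v) : Su v :=
  Sub (val a * val b) (in_Su_mull (val a) (valP b)).

Lemma Su_S u (a : Su u) : in_S (val a).
Proof. by case/in_SuP: (valP a). Qed.
Definition toS u (a : Su u) : structS := Sub (val a) (Su_S a).

Definition fibre (u : Lambda) := {x : X | diag x == val u}.
Lemma fibre_Su u (x : fibre u) : in_Su (val u) (gM r (val x)).
Proof. by have := in_Su_g (val x); rewrite (eqP (valP x)). Qed.
Definition genS u (x : fibre u) : Su u := Sub (gM r (val x)) (fibre_Su x).

(* gr(lambda_x : x in X), inside Sym(X) *)
Definition permutation_group : {group {perm X}} :=
  generated_group [set lamp x | x in [set: X]].

Definition exponent_multiple :=
  {d : nat | (0 < d) && (exponent permutation_group %| d)}.

Lemma lambda_perm m : lambda m \in permutation_group.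
Proof.
rewrite -(mclK m) lambda_cl; elim: (qrepr m) => [|x w IH] /=; first exact: group1.
by rewrite groupM // mem_gen // imset_f.
Qed.

Lemma lambdaXd (d : exponent_multiple) m : lambda m ^+ val d = 1.
Proof.
case/andP: (valP d) => _ /dvdnP[k ->]; rewrite mulnC expgM.
by rewrite expg_exponent ?lambda_perm // expg1n.
Qed.

Section Quotients.
Variables (d : exponent_multiple) (u : Lambda).

(* c_u = (du, id) *)
Definition cM : structM r := piinv (gA (val u) ^+ val d).

Lemma d_gt0 : 0 < val d. Proof. by case/andP: (valP d). Qed.
Lemma pi_c : pi cM = gA (val u) ^+ val d. Proof. exact: piinvK. Qed.
Lemma len_c : lenM cM = val d.
Proof. by rewrite /lenM pi_c lenAX lenA_g muln1. Qed.

Lemma Su_Xd m : in_Su (val u) m -> in_Su (val u) (m ^+ val d).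
Proof. by move=> h; rewrite -(prednK d_gt0) expgSr in_Su_mull. Qed.

Lemma pi_Xd m : in_Su (val u) m -> pi (m ^+ val d) = gA (val u) ^+ (val d * lenM m).
Proof. by case/Su_Xd/in_SuP => _ ->; rewrite lambdaX lambdaXd perm1 lenMX. Qed.

Lemma c_gen x : diag x = val u -> cM = gM r x ^+ val d.
Proof.
move=> hx; apply: pi_inj; rewrite pi_c pi_Xd ?lenM_g ?muln1 //.
by rewrite -hx in_Su_g.
Qed.

Lemma lambda_c : lambda cM = 1.
Proof. by case/codomP: (valP u) => x /esym/c_gen ->; rewrite lambdaX lambdaXd. Qed.

Lemma c_Su : in_Su (val u) cM.
Proof.
case/codomP: (valP u) => x hx; rewrite (c_gen (esym hx)).
by apply: Su_Xd; rewrite {1}hx in_Su_g.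
Qed.

Lemma c_central m : in_Su (val u) m -> m * cM = cM * m.
Proof.
move=> h; have [k hk] := Su_lenP h; case/in_SuP: h => _ h.
apply: pi_inj; rewrite !piM lambda_c actA_id pi_c h hk mulA_gX.
by rewrite actAX actA_g -expgnDr lenAX lenA_g muln1 addnC.
Qed.

Lemma c_centralX m k : in_Su (val u) m -> m * cM ^+ k = cM ^+ k * m.
Proof.
move=> h; elim: k => [|k IH]; first by rewrite mul1g mulg1.
by rewrite expgS mulgA c_central // -!mulgA IH.
Qed.

Lemma Su_power m : in_Su (val u) m -> m ^+ val d = cM ^+ lenM m.
Proof.
move=> h; apply: pi_inj; rewrite pi_Xd //.
elim: (lenM m) => [|k IH]; first by rewrite muln0 pi1.
by rewrite expgS piM lambda_c actA_id pi_c -IH -expgnDr mulnS.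
Qed.

(* The pair (a, n) stands for a o c_u^n; a o c_u^i = b o c_u^j is tested in M
   after multiplication by a large power of c_u.                            *)
Definition frac_rel (p q : Su u * int) : bool :=
  `[< exists k l : nat, val p.1 * cM ^+ k = val q.1 * cM ^+ l /\
                        (p.2 + l%:Z = q.2 + k%:Z)%R >].

Lemma frac_rel_equiv : equiv_class_of frac_rel.
Proof.
split.
- by move=> p; apply/asboolP; exists 0%N, 0%N.
- by move=> p q; apply/asboolP/asboolP => -[k [l [h1 h2]]]; exists l, k.
- move=> q p t /asboolP[k [l [h1 h2]]] /asboolP[k' [l' [h3 h4]]].
  apply/asboolP; exists (k + k')%N, (l + l')%N; split.
    by rewrite expgnDr mulgA h1 -mulgA -expgnDr addnC expgnDr mulgA h3
               -mulgA -expgnDr addnC.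
  by rewrite !PoszD GRing.addrA h2 GRing.addrAC h4 GRing.addrAC GRing.addrA.
Qed.
Canonical frac_equiv_rel := EquivRelPack frac_rel_equiv.

Definition G := {eq_quot frac_rel}.
HB.instance Definition _ := Choice.on G.
HB.instance Definition _ := EqQuotient.on G.

Definition fracG (a : Su u) (n : int) : G := \pi_G (a, n).

Lemma fracP a b i j : fracG a i = fracG b j <-> 
  exists k l : nat, val a * cM ^+ k = val b * cM ^+ l /\ (i + l%:Z = j + k%:Z)%R.
Proof.
by split => [/eqP|h]; [rewrite piE => /asboolP | apply/eqP; rewrite piE; apply/asboolP].
Qed.

Lemma fracK (g : G) : fracG (qrepr g).1 (qrepr g).2 = g.
Proof. by rewrite /fracG -surjective_pairing reprK. Qed.

Lemma fracE (g : G) : exists a i, g = fracG a i.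
Proof. by exists (qrepr g).1, (qrepr g).2; rewrite fracK. Qed.

Definition c : Su u := Sub cM c_Su.
Definition mulG (g h : G) : G :=
  fracG ((qrepr g).1 * (qrepr h).1) ((qrepr g).2 + (qrepr h).2)%R.
Definition oneG : G := fracG c (-1)%R.
Definition inv_Su (a : Su u) : Su u :=
  Sub (val a ^+ (val d).-1 * cM) (in_Su_mull _ c_Su).
Definition invG (g : G) : G :=
  let a := (qrepr g).1 in
  fracG (inv_Su a) (- (qrepr g).2 - (lenM (val a)).+1%:Z)%R.

Lemma mulG_frac a b i j : mulG (fracG a i) (fracG b j) = fracG (a * b) (i + j)%R.
Proof.
have /fracP[k [l [h1 h2]]] := fracK (fracG a i).
have /fracP[k' [l' [h3 h4]]] := fracK (fracG b j).
apply/fracP; exists (k + k')%N, (l + l')%N; split.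
  have E (x y : Su u) (m n : nat) : val (x * y) * cM ^+ (m + n) =
      (val x * cM ^+ m) * (val y * cM ^+ n).
    by rewrite -!mulgA (mulgA (cM ^+ m)) -c_centralX ?(valP y) // expgnDr !mulgA.
  by rewrite !E h1 h3.
by rewrite !PoszD GRing.addrACA h2 h4 GRing.addrACA.
Qed.

Lemma mulGA : associative mulG.
Proof.
move=> g h t; case: (fracE g) (fracE h) (fracE t) => [a [i ->]] [b [j ->]] [e [k ->]].
by rewrite !mulG_frac mulgA GRing.addrA.
Qed.

Lemma mul1G : left_id oneG mulG.
Proof.
move=> g; case: (fracE g) => a [i ->]; rewrite mulG_frac; apply/fracP.
exists 0%N, 1%N; split; first by rewrite mulg1 c_centralX ?(valP a).
by rewrite GRing.addr0 GRing.addrC GRing.addrA GRing.addrN GRing.add0r.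
Qed.

Lemma mulG1 : right_id oneG mulG.
Proof.
move=> g; case: (fracE g) => a [i ->]; rewrite mulG_frac; apply/fracP.
exists 0%N, 1%N; split; first by rewrite mulg1.
by rewrite GRing.addr0 GRing.addrNK.
Qed.

Lemma powc (a b : Su u) : val a * val b = cM ^+ (lenM (val a)).+1 ->
  forall i j : int, (i + j = - (lenM (val a)).+1%:Z)%R -> fracG (a * b) (i + j)%R = oneG.
Proof.
move=> h i j ->; apply/fracP; exists 0%N, (lenM (val a)); split.
  by rewrite mulg1 [LHS]h expgS.
rewrite GRing.addr0 -addn1 PoszD GRing.opprD GRing.addrAC GRing.addNr.
by rewrite GRing.add0r.
Qed.

Lemma mulVG : left_inverse oneG invG mulG.
Proof.
move=> g; rewrite -{2}(fracK g) mulG_frac; set a := (qrepr g).1.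
have h : val (inv_Su a) * val a = val a * val (inv_Su a).
  rewrite /= -mulgA -c_central ?(valP a) // !mulgA; congr (_ * _).
  by rewrite -expgSr expgS.
have -> : inv_Su a * a = a * inv_Su a by apply: val_inj.
apply: powc; last by rewrite GRing.addrAC GRing.addNr GRing.add0r.
by rewrite /= mulgA -expgS prednK ?d_gt0 // Su_power ?(valP a) // -expgSr.
Qed.

Lemma mulGV : right_inverse oneG invG mulG.
Proof.
move=> g; rewrite -{1}(fracK g) mulG_frac; set a := (qrepr g).1.
apply: powc; last by rewrite GRing.addrA GRing.addrN GRing.add0r.
by rewrite /= mulgA -expgS prednK ?d_gt0 // Su_power ?(valP a) // -expgSr.
Qed.

HB.instance Definition _ := isGroup.Build G mulGA mul1G mulG1 mulVG mulGV.

Lemma frac_mul a b i j : fracG a i * fracG b j = fracG (a * b) (i + j)%R.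
Proof. exact: mulG_frac. Qed.

Definition lenG (g : G) : int :=
  ((lenM (val (qrepr g).1))%:Z + (val d)%:Z * (qrepr g).2)%R.

Lemma lenG_frac a i : lenG (fracG a i) = ((lenM (val a))%:Z + (val d)%:Z * i)%R.
Proof.
have /fracP[k [l [/(congr1 lenM) h1 h2]]] := fracK (fracG a i).
move: h1; rewrite !lenMM !lenMX len_c => /(congr1 Posz) h1.
move: h2 h1; rewrite /lenG; move: (qrepr _).2 (lenM _) (lenM _) => j m n.
by rewrite !PoszD !PoszM; lia.
Qed.

Lemma lenG_mul g h : lenG (g * h) = (lenG g + lenG h)%R.
Proof.
case: (fracE g) (fracE h) => [a [i ->]] [b [j ->]].
by rewrite frac_mul !lenG_frac lenMM PoszD GRing.mulrDr GRing.addrACA.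
Qed.

Lemma lenG1 : lenG 1 = 0%R.
Proof. by have := lenG_mul 1 1; rewrite mulg1; lia. Qed.

Lemma lenGX g (n : nat) : lenG (g ^+ n) = (n%:Z * lenG g)%R.
Proof.
elim: n => [|k IH]; first by rewrite lenG1 GRing.mul0r.
by rewrite expgS lenG_mul IH; lia.
Qed.

Lemma frac_X a i (n : nat) : fracG a i ^+ n.+1 = fracG (Sub (val a ^+ n * val a)
  (in_Su_mull _ (valP a))) (n.+1%:Z * i)%R.
Proof.
elim: n => [|n IH].
  by rewrite expg1 GRing.mul1r; congr fracG; apply: val_inj; rewrite /= mul1g.
rewrite expgS IH frac_mul; congr fracG; last by lia.
by apply: val_inj; rewrite /= mulgA -expgS.
Qed.

Lemma torsionP g : reflect (lenG g = 0%R) (g \in torsion G).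
Proof.
apply: (iffP (asboolP _)) => [[n n0 /(congr1 lenG)]|].
  by rewrite lenGX lenG1 => /eqP; rewrite GRing.mulf_eq0 => /orP[|/eqP //]; lia.
case: (fracE g) => a [i ->]; rewrite lenG_frac => h; exists (val d); first exact: d_gt0.
rewrite -(prednK d_gt0) frac_X prednK ?d_gt0 //; apply/fracP.
exists 1%N, (lenM (val a)); split; last by lia.
by rewrite /= -expgSr prednK ?d_gt0 // Su_power ?(valP a) // -expgSr expgS.
Qed.

Lemma torsion_closed : group_closed (torsion G).
Proof.
have t1 : 1 \in torsion G by apply/torsionP/lenG1.
split=> // g h /torsionP hg /torsionP hh; apply/torsionP.
rewrite lenG_mul hg; have := lenG_mul h h^-1.
by rewrite mulgV lenG1 hh; lia.
Qed.

Definition T := {g : G | torsion G g}.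
HB.instance Definition _ := SubChoice.on T.
HB.instance Definition _ := SubChoice_isSubGroup.Build G (torsion G) T torsion_closed.

(* (x, lambda_x) in G_u, for x in X with q(x) = u *)
Definition genG (x : fibre u) : G := fracG (genS x) 0.

End Quotients.
End StructureMonoid.

(* Elements are [Tagged (G d) g], with g in G_u. *)
Definition Ge (X : finType) (r : solution X) (d : exponent_multiple r) : Type :=
  {u : Lambda r & G d u}.
HB.instance Definition _ X r d := Choice.on (@Ge X r d).

Definition inG (X : finType) (r : solution X) (d : exponent_multiple r)
  (u : Lambda r) (g : G d u) : Ge d := Tagged (G d) g.

Section Semigroups.
Variables (E : Type) (op : E -> E -> E).

Definition left_cancellative : Prop := forall a, injective (op a).

Definition two_sided_ideal (I : E -> Prop) : Prop :=
  forall a b, I a -> I (op a b) /\ I (op b a).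
Definition simple_semigroup : Prop :=
  forall I : E -> Prop, two_sided_ideal I -> (exists a, I a) -> forall a, I a.

Inductive generated_subsemigroup (P : E -> Prop) : E -> Prop :=
| Gen_base a : P a -> generated_subsemigroup P a
| Gen_op a b : generated_subsemigroup P a -> generated_subsemigroup P b ->
    generated_subsemigroup P (op a b).
End Semigroups.

Definition semigroup_iso (E F : Type) (opE : E -> E -> E) (opF : F -> F -> F)
  (f : E -> F) : Prop :=
  bijective f /\ {morph f : x y / opE x y >-> opF x y}.

(* M(G, 1, m, J) *)
Definition rees (H : Type) (m : nat) : Type := (H * 'I_1 * 'I_m)%type.
Definition rees_mul (H : groupType) (m : nat) (a b : rees H m) : rees H m :=
  (a.1.1 * b.1.1, ord0, b.2).

Definition zgr (H : groupType) (x : H) : pred H := [pred g | `[< exists n, g = zexpg x n >]].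

Definition internal_sdprod (H : groupType) (N Q : pred H) : Prop :=
  [/\ group_closed N /\ group_closed Q,
      forall g n, n \in N -> n ^ g \in N,
      forall g, g \in N -> g \in Q -> g = 1 &
      forall g, exists n q, [/\ n \in N, q \in Q & g = n * q]].

(* The n-th power of an automorphism s with inverse s'. *)
Definition zaut (E : Type) (s s' : E -> E) (n : int) : E -> E :=
  match n with Posz k => iter k s | Negz k => iter k.+1 s' end.

(* N x|_s Z *)
Definition sdprodZ_mul (N : groupType) (s s' : N -> N) (p q : N * int) : N * int :=
  (p.1 * zaut s s' p.2 q.1, (p.2 + q.2)%R).

Section Conjugation.
Variables (X : finType) (r : solution X) (d : exponent_multiple r) (u : Lambda r).

Lemma torsion_conj (g : G d u) (t : T d u) : torsion (G d u) (g * val t * g^-1).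
Proof.
apply/torsionP; rewrite !lenG_mul; have /torsionP -> := valP t.
by have := lenG_mul g g^-1; rewrite mulgV lenG1; lia.
Qed.
Definition conjT (g : G d u) (t : T d u) : T d u := Sub (g * val t * g^-1) (torsion_conj g t).

(* sigma_u and its inverse, for x = x_u *)
Definition sigma (x : fibre u) : T d u -> T d u := conjT (genG d x).
Definition sigma_inv (x : fibre u) : T d u -> T d u := conjT (genG d x)^-1.
Lemma sigmaK x : cancel (sigma x) (sigma_inv x).
Proof. by move=> t; apply: val_inj; rewrite /= invgK !mulgA mulVg mul1g mulgKV. Qed.
Lemma sigmaKV x : cancel (sigma_inv x) (sigma x).
Proof. by move=> t; apply: val_inj; rewrite /= invgK !mulgA mulgV mul1g mulgK. Qed.
End Conjugation.
Arguments sigma {X r} d {u} x t.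
Arguments sigma_inv {X r} d {u} x t.

Local Open Scope ring_scope.

Section Algebras.
Variable K : fieldType.

(* [{malg K[E]}] is the K-vector space with basis E. It becomes the semigroup
   algebra of (E, op) with the K-linear extension of op, which has no unit in
   general.                                                                 *)
Definition salg_mul (E : choiceType) (op : E -> E -> E) (f g : {malg K[E]}) : {malg K[E]} :=
  \sum_(x <- msupp f) \sum_(y <- msupp g) << f@_x * g@_y *g op x y >>.

(* K-linear extension of a map between bases *)
Definition salg_map (E F : choiceType) (h : E -> F) (f : {malg K[E]}) : {malg K[F]} :=
  \sum_(x <- msupp f) << f@_x *g h x >>.

Section SkewLaurent.
Variables (V : lmodType K) (mul : V -> V -> V) (s s' : V -> V).

(* [<< a *g n >>] is the monomial a t^n; the product is determined by
   t a = s(a) t, where s' is the inverse of s.                              *)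
Definition skew_mul (f g : {malg V[int]}) : {malg V[int]} :=
  \sum_(n <- msupp f) \sum_(m <- msupp g)
    << mul f@_n (zaut s s' n g@_m) *g (n + m) >>.

Definition skew_scale (k : K) (f : {malg V[int]}) : {malg V[int]} :=
  \sum_(n <- msupp f) << k *: f@_n *g n >>.
End SkewLaurent.

Definition nonunital_algebra (V : lmodType K) (mul : V -> V -> V) : Prop :=
  [/\ associative mul, left_distributive mul +%R, right_distributive mul +%R &
      forall (k : K) a b, mul (k *: a) b = k *: mul a b /\ mul a (k *: b) = k *: mul a b].

(* V is the direct sum of the images of the W i and is graded by (I, op). *)
Definition graded_sum (I : finType) (op : I -> I -> I) (V : lmodType K)
    (mul : V -> V -> V) (W : I -> lmodType K) (j : forall i, W i -> V) : Prop :=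
  [/\ forall i, linear (j i),
      forall v, exists! w : forall i, W i, v = \sum_i j i (w i) &
      forall i k a b, exists c, mul (j i a) (j k b) = j (op i k) c].
End Algebras.

(* Main.v *)
(* The element c_u of length d satisfies c_u m = m c_v for every m in S_v, so the
   product of S extends to the fractions that form G^e. The identity e_u of each
   G_u is then a left identity of G^e, whence simplicity and the isomorphism
   g |-> (g e_u, v) (g in G_v) with M(G_u, 1, |Lambda|, J); left cancellation
   comes from the uniqueness of the normal form nx in A.
   The length extends to a homomorphism G_u -> Z with kernel T(G_u) that sends
   every generator with q(x) = u to 1, and an element of G_u of length 1 is such a
   generator. This splits G_u over <x_u> and gives both T(G_u) = {x x_u^-1} and
   the generators t x_u of S. The statements on algebras are K-linear extensions
   of those on their bases. *)
Require Import Defs.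
From mathcomp Require Import all_boot all_order all_algebra all_fingroup.
From mathcomp Require Import finmap boolp zify.
From mathcomp.multinomials Require Import monalg.

Set Implicit Arguments.
Unset Strict Implicit.
Unset Printing Implicit Defensive.

Import GRing.Theory.
Local Open Scope ring_scope.

(** * Additive maps on formal sums *)

Lemma morphD0 (A B : zmodType) (F : A -> B) : {morph F : a b / a + b} -> F 0 = 0.
Proof. by move=> h; apply: (addIr (F 0)); rewrite -h !add0r. Qed.

Section AdditiveExtension.
Variables (E : choiceType) (V W : zmodType).

Lemma malg_ind (P : {malg V[E]} -> Prop) :
  P 0 -> (forall f g, P f -> P g -> P (f + g)) -> (forall c k, P << c *g k >>) ->
  forall f, P f.
Proof.
move=> P0 PD PU f; rewrite (monalgE f).
by apply: big_ind.
Qed.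

Lemma malg_additive_ext (F H : {malg V[E]} -> W) :
  {morph F : f g / f + g} -> {morph H : f g / f + g} ->
  (forall c k, F << c *g k >> = H << c *g k >>) -> forall f, F f = H f.
Proof.
move=> FD HD FH; apply: malg_ind => // [|f g hf hg].
  by rewrite !morphD0.
by rewrite FD HD hf hg.
Qed.

(** [salg_map] and [skew_scale] unfold to this form, [salg_mul] and [skew_mul] to a nested one, so
    additivity and values on monomials are settled here once. *)
Definition malg_extend (phi : E -> V -> W) (f : {malg V[E]}) : W :=
  \sum_(k <- msupp f) phi k f@_k.

Variable phi : E -> V -> W.
Hypothesis phiD : forall k, {morph phi k : a b / a + b}.

(** Indices outside the support contribute [phi k 0 = 0], so [f], [g] and [f + g] can be summed over
    one common set. *)
Lemma malg_extendEw (D : {fset E}) (f : {malg V[E]}) :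
  (msupp f `<=` D)%fset -> malg_extend phi f = \sum_(k <- D) phi k f@_k.
Proof.
move=> h; apply: big_fset_incl => // k _ /mcoeff_outdom ->.
exact: morphD0.
Qed.

Lemma malg_extendD : {morph malg_extend phi : f g / f + g}.
Proof.
move=> f g; rewrite (malg_extendEw (msuppD_le f g)) (malg_extendEw (fsubsetUl _ (msupp g))).
rewrite (malg_extendEw (fsubsetUr (msupp f) _)) -big_split /=.
by apply: eq_bigr => k _; rewrite mcoeffD phiD.
Qed.

Lemma malg_extendU c k : malg_extend phi << c *g k >> = phi k c.
Proof. by rewrite (malg_extendEw msuppU_le) big_seq_fset1 mcoeffUU. Qed.
End AdditiveExtension.

(** * Semigroup algebras and their maps *)

Section SemigroupAlgebra.
Variable K : fieldType.

Lemma malgZU (E : choiceType) (c a : K) (k : E) :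
  c *: << a *g k >> = << c * a *g k >> :> {malg K[E]}.
Proof. by apply/malgP => l; rewrite mcoeffZ !mcoeffU mulrnAr. Qed.

Section Map.
Variables (E F : choiceType) (h : E -> F).

Lemma salg_mapD : {morph @salg_map K E F h : f g / f + g}.
Proof. by apply: (malg_extendD (phi := fun k c => << c *g h k >>)) => k a b; rewrite monalgUD. Qed.

Lemma salg_mapU c k : salg_map h << c *g k >> = << c *g h k >> :> {malg K[F]}.
Proof. by rewrite [LHS](malg_extendU (phi := fun k c => << c *g h k >>)) // => l a b; rewrite monalgUD. Qed.

Lemma salg_map_linear : linear (@salg_map K E F h).
Proof.
move=> c f g; rewrite salg_mapD; congr (_ + _).
move: f; apply: malg_additive_ext => [f f'|f f'|a k].
- by rewrite scalerDr salg_mapD.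
- by rewrite salg_mapD scalerDr.
- by rewrite malgZU !salg_mapU malgZU.
Qed.

Lemma mcoeff_salg_map (f : {malg K[E]}) y : injective h -> (salg_map h f)@_(h y) = f@_y.
Proof.
move=> h_inj; move: f; apply: malg_additive_ext => [f g|f g|a k].
- by rewrite salg_mapD mcoeffD.
- exact: mcoeffD.
- by rewrite salg_mapU !mcoeffU (inj_eq h_inj).
Qed.

Lemma mcoeff_salg_map0 (f : {malg K[E]}) z : (forall y, h y != z) -> (salg_map h f)@_z = 0.
Proof.
move=> hz; move: f; apply: malg_additive_ext => [f g|f g|a k].
- by rewrite salg_mapD mcoeffD.
- by rewrite addr0.
- by rewrite salg_mapU !mcoeffU (negPf (hz k)).
Qed.

Lemma salg_map_inj : injective h -> injective (@salg_map K E F h).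
Proof.
by move=> h_inj f g fg; apply/malgP => y; rewrite -!(mcoeff_salg_map _ _ h_inj) fg.
Qed.
End Map.

Section Product.
Variables (E : choiceType) (op : E -> E -> E).
Local Notation "f ** g" := (@salg_mul K E op f g) (at level 40, left associativity).
Implicit Types f g h : {malg K[E]}.

Let coef_mulr x a (y : E) : {morph (fun b : K => << a * b *g op x y >>) : b c / b + c}.
Proof. by move=> b c; rewrite mulrDr monalgUD. Qed.

Let coef_mull (g : {malg K[E]}) x :
  {morph (fun a : K => malg_extend (fun y b => << a * b *g op x y >>) g) : a b / a + b}.
Proof.
by move=> a b; rewrite -big_split; apply: eq_bigr => y _; rewrite mulrDl monalgUD.
Qed.

Lemma salg_mulDl : left_distributive (@salg_mul K E op) +%R.
Proof. by move=> f g h; apply: (malg_extendD (coef_mull h)). Qed.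

Lemma salg_mulDr : right_distributive (@salg_mul K E op) +%R.
Proof.
move=> f g h; rewrite -big_split; apply: eq_bigr => x _.
exact: (malg_extendD (coef_mulr x f@_x)).
Qed.

Lemma salg_mul0l f : 0 ** f = 0.
Proof. by rewrite /salg_mul msupp0 big_seq_fset0. Qed.

Lemma salg_mul0r f : f ** 0 = 0.
Proof. by rewrite /salg_mul big1 // => x _; rewrite msupp0 big_seq_fset0. Qed.

Lemma salg_mulU a b x y : << a *g x >> ** << b *g y >> = << a * b *g op x y >>.
Proof. by rewrite [LHS](malg_extendU (coef_mull _)) (malg_extendU (coef_mulr x a)). Qed.

Lemma salg_mulA : associative op -> associative (@salg_mul K E op).
Proof.
move=> opA f g h; move: f; apply: malg_additive_ext => [f f'|f f'|a k].
- exact: salg_mulDl.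
- by rewrite !salg_mulDl.
move: g; apply: malg_additive_ext => [g g'|g g'|b l].
- by rewrite salg_mulDl salg_mulDr.
- by rewrite salg_mulDr salg_mulDl.
move: h; apply: malg_additive_ext => [h h'|h h'|c m].
- by rewrite !salg_mulDr.
- exact: salg_mulDr.
by rewrite !salg_mulU opA mulrA.
Qed.

Lemma salg_mulZl c f g : (c *: f) ** g = c *: (f ** g).
Proof.
move: f; apply: malg_additive_ext => [f f'|f f'|a k].
- by rewrite scalerDr salg_mulDl.
- by rewrite salg_mulDl scalerDr.
move: g; apply: malg_additive_ext => [g g'|g g'|b l].
- exact: salg_mulDr.
- by rewrite salg_mulDr scalerDr.
by rewrite malgZU !salg_mulU malgZU mulrA.
Qed.

Lemma salg_mulZr c f g : f ** (c *: g) = c *: (f ** g).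
Proof.
move: f; apply: malg_additive_ext => [f f'|f f'|a k].
- exact: salg_mulDl.
- by rewrite salg_mulDl scalerDr.
move: g; apply: malg_additive_ext => [g g'|g g'|b l].
- by rewrite scalerDr salg_mulDr.
- by rewrite salg_mulDr scalerDr.
by rewrite malgZU !salg_mulU malgZU mulrCA.
Qed.

Lemma salg_nonunital : associative op -> nonunital_algebra (@salg_mul K E op).
Proof.
move=> opA; split; [exact: salg_mulA|exact: salg_mulDl|exact: salg_mulDr|].
by move=> c f g; rewrite salg_mulZl salg_mulZr.
Qed.
End Product.

Lemma salg_map_mul (E F : choiceType) (opE : E -> E -> E) (opF : F -> F -> F) (h : E -> F) :
  {morph h : x y / opE x y >-> opF x y} -> forall f g : {malg K[E]},
  salg_map h (salg_mul opE f g) = salg_mul opF (salg_map h f) (salg_map h g).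
Proof.
move=> hM f g; move: f; apply: malg_additive_ext => [f f'|f f'|a k].
- by rewrite salg_mulDl salg_mapD.
- by rewrite salg_mapD salg_mulDl.
move: g; apply: malg_additive_ext => [g g'|g g'|b l].
- by rewrite salg_mulDr salg_mapD.
- by rewrite salg_mapD salg_mulDr.
by rewrite salg_mulU !salg_mapU salg_mulU hM.
Qed.

(** * Direct sums and gradings *)

Section Graded.
Variables (I : finType) (W : I -> choiceType) (opI : I -> I -> I).
Local Notation E := {i : I & W i}.
Variable op : E -> E -> E.
Hypothesis tag_op : forall a b, tag (op a b) = opI (tag a) (tag b).
Local Notation j i := (@salg_map K (W i) E (Tagged (fun i => W i : Type))).

Let Tagged_inj i : injective (Tagged (fun i => W i : Type) : W i -> E).
Proof. by move=> y z /eqP; rewrite -tag_eqE /tag_eq eqxx /= tagged_asE => /eqP. Qed.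

(** Summands other than [k] live on basis elements with other tags. This yields uniqueness of the
    decomposition. *)
Let mcoeff_sum (w : forall i, {malg K[W i]}) k y :
  (\sum_i j i (w i))@_(Tagged (fun i => W i : Type) y) = (w k)@_y.
Proof.
rewrite raddf_sum (bigD1 k) //= mcoeff_salg_map //.
rewrite big1 ?addr0 // => i ik; apply: mcoeff_salg_map0 => z.
by apply: contraNneq ik => /(congr1 tag) /= ->.
Qed.

Lemma salg_graded_sum : graded_sum opI (@salg_mul K E op) (fun i => j i).
Proof.
have jD i : {morph j i : f g / f + g} by move=> f g; rewrite salg_mapD.
have j0 i : j i 0 = 0 by exact: (morphD0 (jD i)).
split=> [i|v|i k].
- exact: salg_map_linear.
- have [w vw] : exists w : forall i, {malg K[W i]}, v = \sum_i j i (w i).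
    move: v; apply: malg_ind => [|f g [wf ->] [wg ->]|c [i y]].
    + by exists (fun=> 0); rewrite big1 // => i _; rewrite j0.
    + by exists (fun i => wf i + wg i); rewrite -big_split; apply: eq_bigr => i _; rewrite jD.
    + exists (dfwith (fun k => 0 : {malg K[W k]}) << c *g y >>).
      rewrite (bigD1 i) //= dfwith_in salg_mapU big1 ?addr0 // => k ki.
      by rewrite dfwith_out // eq_sym.
  exists w; split=> // w' vw'; apply: functional_extensionality_dep => k.
  by apply/malgP => y; rewrite -(mcoeff_sum w) -(mcoeff_sum w') -vw -vw'.
- apply: malg_ind => [b|f g hf hg b|a y].
  + by exists 0; rewrite !j0 salg_mul0l.
  + have [[c hc] [c' hc']] := (hf b, hg b); exists (c + c').
    by rewrite !jD salg_mulDl hc hc'.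
  apply: malg_ind => [|f g [c hc] [c' hc']|b z].
  + by exists 0; rewrite !j0 salg_mul0r.
  + by exists (c + c'); rewrite !jD salg_mulDr hc hc'.
  rewrite !salg_mapU salg_mulU; set g := op _ _.
  have : tag g = opI i k by exact: tag_op.
  (* With [g] split into tag and component, the tag equation turns [opI i k] into [l], the index
     that the component has. *)
  case: g => l g /= lik; rewrite -{}lik.
  by exists << a * b *g g >>; rewrite salg_mapU.
Qed.
End Graded.

(** * Skew Laurent polynomials and semidirect products with the integers *)

Section SkewLaurentGroup.
Variables (N H : groupType) (s s' : N -> N) (v : N -> H) (x : H).
Let F (p : N * int) : H := (v p.1 * zexpg x p.2)%g.
Hypothesis F_iso : semigroup_iso (sdprodZ_mul s s') *%g F.

Let Phi : {malg {malg K[N]}[int]} -> {malg K[H]} :=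
  malg_extend (fun n a => malg_extend (fun t c => << c *g F (t, n) >>) a).

Let inD n t : {morph (fun c : K => << c *g F (t, n) >>) : a b / a + b}.
Proof. by move=> a b; rewrite monalgUD. Qed.
Let outD n : {morph malg_extend (fun t (c : K) => << c *g F (t, n) >>) : a b / a + b}.
Proof. exact: (malg_extendD (inD n)). Qed.

Let PhiD : {morph Phi : f g / f + g}.
Proof. exact: (malg_extendD outD). Qed.

Let PhiU c t n : Phi << << c *g t >> *g n >> = << c *g F (t, n) >>.
Proof. by rewrite [LHS](malg_extendU outD) (malg_extendU (inD n)). Qed.

Let zautU n (c : K) t :
  zaut (salg_map s) (salg_map s') n << c *g t >> = << c *g zaut s s' n t >>.
Proof.
have iterU (h : N -> N) k : iter k (salg_map h) << c *g t >> = << c *g iter k h t >>.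
  by elim: k => //= k ->; rewrite salg_mapU.
by case: n => k; exact: iterU.
Qed.

Let zautD n : {morph zaut (@salg_map K N N s) (salg_map s') n : a b / a + b}.
Proof.
have iterD (h : N -> N) k : {morph iter k (@salg_map K N N h) : a b / a + b}.
  by elim: k => [//|k IH] a b; rewrite !iterS IH salg_mapD.
by case: n => k; exact: iterD.
Qed.

Local Notation smul := (skew_mul (@salg_mul K N *%g) (salg_map s) (salg_map s')).

Let smulDr_coef n (a : {malg K[N]}) m : {morph (fun b =>
  << salg_mul *%g a (zaut (salg_map s) (salg_map s') n b) *g n + m >>) : b c / b + c}.
Proof. by move=> b c; rewrite zautD salg_mulDr monalgUD. Qed.

Let smulDl_coef (g : {malg {malg K[N]}[int]}) n : {morph (fun a => malg_extend (fun m b =>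
  << salg_mul *%g a (zaut (salg_map s) (salg_map s') n b) *g n + m >>) g) : a b / a + b}.
Proof.
by move=> a b; rewrite -big_split; apply: eq_bigr => y _; rewrite salg_mulDl monalgUD.
Qed.

Let smulDl f f' g : smul (f + f') g = smul f g + smul f' g.
Proof. exact: (malg_extendD (smulDl_coef g)). Qed.

Let smulDr f g g' : smul f (g + g') = smul f g + smul f g'.
Proof.
rewrite -big_split; apply: eq_bigr => n _.
exact: (malg_extendD (smulDr_coef n f@_n)).
Qed.

Let smulU n m a b : smul << a *g n >> << b *g m >> =
  << salg_mul *%g a (zaut (salg_map s) (salg_map s') n b) *g n + m >>.
Proof. by rewrite [LHS](malg_extendU (smulDl_coef _)) (malg_extendU (smulDr_coef n a)). Qed.

Let malg2_additive_ext (P : zmodType) (A B : {malg {malg K[N]}[int]} -> P) :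
  {morph A : f g / f + g} -> {morph B : f g / f + g} ->
  (forall c t n, A << << c *g t >> *g n >> = B << << c *g t >> *g n >>) -> forall f, A f = B f.
Proof.
move=> AD BD AB; apply: malg_additive_ext => // a n; move: a.
apply: malg_additive_ext => [a b|a b|c t //].
- by rewrite monalgUD AD.
- by rewrite monalgUD BD.
Qed.

(** The pairs [(t, n)] form a K-basis on the skew side, and [F] maps it bijectively and
    multiplicatively onto the basis [H]; additivity does the rest. *)
Lemma skew_laurent_group :
  exists Phi : {malg {malg K[N]}[int]} -> {malg K[H]},
     [/\ bijective Phi,
         {morph Phi : f g / f + g},
         forall (k : K) f, Phi (skew_scale k f) = k *: Phi f,
         forall f g, Phi (smul f g) = salg_mul *%g (Phi f) (Phi g) &
         forall (a : {malg K[N]}) (n : int),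
           Phi << a *g n >> = salg_mul *%g (salg_map v a) << 1 *g zexpg x n >>].
Proof.
have [[F' FK F'K] FM] := F_iso.
exists Phi; split=> //.
- pose psi (h : H) (c : K) : {malg {malg K[N]}[int]} := << << c *g (F' h).1 >> *g (F' h).2 >>.
  have psiD h : {morph psi h : a b / a + b} by move=> a b; rewrite /psi !monalgUD.
  exists (malg_extend psi).
  + apply: malg2_additive_ext => // [f g|c t n].
      by rewrite PhiD malg_extendD.
    by rewrite PhiU malg_extendU // /psi FK.
  + apply: malg_additive_ext => // [f g|c h].
      by rewrite malg_extendD // PhiD.
    by rewrite malg_extendU // PhiU -surjective_pairing F'K.
- move=> k.
  have sc (n : int) : {morph (fun a : {malg K[N]} => << k *: a *g n >>) : a b / a + b}.
    by move=> a b; rewrite scalerDr monalgUD.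
  have scD f g : skew_scale k (f + g) = skew_scale k f + skew_scale k g :=
    malg_extendD sc f g.
  have scU a n : skew_scale k << a *g n >> = << k *: a *g n >> := malg_extendU sc a n.
  apply: malg2_additive_ext => [f g|f g|c t n].
  + by rewrite scD PhiD.
  + by rewrite PhiD scalerDr.
  + by rewrite scU malgZU !PhiU malgZU.
- move=> f g; move: f; apply: malg2_additive_ext => [f f'|f f'|c t n].
  + by rewrite smulDl PhiD.
  + by rewrite PhiD salg_mulDl.
  move: g; apply: malg2_additive_ext => [g g'|g g'|c' t' n'].
  + by rewrite smulDr PhiD.
  + by rewrite PhiD salg_mulDr.
  by rewrite smulU zautU salg_mulU !PhiU salg_mulU -(FM (t, n) (t', n')).
- move=> a n; move: a; apply: malg_additive_ext => [a b|a b|c t].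
  + by rewrite monalgUD PhiD.
  + by rewrite salg_mapD salg_mulDl.
  by rewrite PhiU salg_mapU salg_mulU mulr1.
Qed.
End SkewLaurentGroup.
End SemigroupAlgebra.

(** * Normal forms in A and left cancellation in S *)

Section StructureSemigroup.
Local Open Scope group_scope.

(** Rewriting [[:: x; y]] to [[:: y; y]] keeps the last letter; this invariant separates the
    elements nx of equal length. *)
Lemma mcong_derived_last (X : choiceType) (z : X) (v w : seq X) :
  mcong (@derived_rel X) v w -> last z v = last z w.
Proof.
elim=> {v w} [//|//|u v w _ -> _ -> //|s t v w [y y']].
by rewrite !last_cat.
Qed.

(** The power is the class of the word y...y, and [n.+1] ensures that it has a last letter. *)
Lemma gAX_inj (X : finType) (n : nat) : injective (fun y : X => gA y ^+ n.+1).
Proof.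
have gAX (t : X) k : gA t ^+ k = mcl (nseq k t).
  by elim: k => // k IH; rewrite expgS IH mclM.
have lastX (y t : X) k : last y (nseq k.+1 t) = t by elim: k.
by move=> y z; rewrite !gAX => /mclP/(mcong_derived_last y); rewrite !lastX.
Qed.

Variables (X : finType) (r : solution X).
Implicit Types m n : structM r.

Lemma lenM_Su u m : in_Su u m -> lenM m = (lenM m).-1.+1.
Proof. by case/Su_lenP => k ->. Qed.

(** Length and letter determine the normal form of [pi m], and [pi] is injective. *)
Lemma Su_eq u v m n : in_Su u m -> in_Su v n -> lenM m = lenM n ->
  lambda m u = lambda n v -> m = n.
Proof.
by move=> /in_SuP[_ hm] /in_SuP[_ hn] hl hu; apply: pi_inj; rewrite hm hn hl hu.
Qed.

Lemma Su_uniq u v m : in_Su u m -> in_Su v m -> u = v.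
Proof.
move=> hu; have hl := lenM_Su hu; case/in_SuP: hu => _ p /in_SuP[_].
by rewrite p hl => /gAX_inj/perm_inj.
Qed.

(** A word ending in [y] lies in S_{q(y)}, because [gM r y] does and S_{q(y)} absorbs factors on the
    left. *)
Lemma S_in_Su m : in_S m -> exists u : Lambda r, in_Su (val u) m.
Proof.
rewrite -(mclK m) /=; case: (lastP (generic_quotient.repr m)) => [|w y] h.
  by case/eqP: h.
exists (Sub (diag r y) (codom_f _ y)).
by rewrite -cats1 -mclM in_Su_mull ?in_Su_g.
Qed.

(** Lengths agree by additivity. Comparing the letters in the normal forms of the products then
    leaves only the permutation [lambda m] to cancel. *)
Lemma Su_mulI u v m n n' : in_Su u n -> in_Su v n' -> m * n = m * n' -> n = n'.
Proof.
move=> hn hn' e; have l : lenM n = lenM n'.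
  by have := congr1 (@lenM _ r) e; rewrite !lenMM => /addnI.
apply: (Su_eq hn hn' l).
have [/in_SuP[_ p] /in_SuP[_ p']] := (in_Su_mull m hn, in_Su_mull m hn').
move: p'; rewrite -e p lenMM (lenM_Su hn) addnS => /gAX_inj.
by rewrite {2}e !lambda_mul !permM => /perm_inj.
Qed.

(** Both products lie in S_v, have length d + |m| and the same permutation [lambda m]. This exchange
    rule makes the product of fractions from different groups well defined. *)
Lemma c_mul (d : exponent_multiple r) (u v : Lambda r) m :
  in_Su (val v) m -> cM d u * m = m * cM d v.
Proof.
move=> h; apply: (Su_eq (in_Su_mull _ h) (in_Su_mull _ (c_Su d v))).
  by rewrite !lenMM !len_c addnC.
by rewrite !lambda_mul !lambda_c mul1g mulg1.
Qed.

Lemma c_mulX (d : exponent_multiple r) (u v : Lambda r) m k :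
  in_Su (val v) m -> cM d u ^+ k * m = m * cM d v ^+ k.
Proof.
move=> h; elim: k => [|k IH]; first by rewrite mul1g mulg1.
by rewrite expgS -mulgA IH mulgA (c_mul _ _ h) -mulgA -expgS.
Qed.
End StructureSemigroup.

(** * Integer powers in a group *)

Section IntegerPowers.
Local Open Scope group_scope.
Variables (H : groupType) (x : H).

Lemma zexpgS (n : int) : zexpg x (n + 1)%R = zexpg x n * x.
Proof.
case: n => [n|[|n]]; first by rewrite /= addn1 expgSr.
  by rewrite /= expg1 mulVg.
have -> : (Negz n.+1 + 1)%R = Negz n by lia.
by rewrite /= -!expVgn [in RHS]expgSr mulgKV.
Qed.

Lemma zexpgP (n : int) : zexpg x (n - 1)%R = zexpg x n * x^-1.
Proof. by rewrite -{2}(subrK 1%R n) zexpgS mulgK. Qed.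

Lemma zexpgD (m n : int) : zexpg x (m + n)%R = zexpg x m * zexpg x n.
Proof.
elim/int_rect: n => [|n IH|n IH]; first by rewrite addr0 mulg1.
- by rewrite -addn1 PoszD addrA !zexpgS IH mulgA.
- by rewrite -addn1 PoszD opprD addrA !zexpgP IH mulgA.
Qed.

Lemma zexpgN (n : int) : zexpg x (- n)%R = (zexpg x n)^-1.
Proof. by apply: (mulIg (zexpg x n)); rewrite -zexpgD addNr mulVg. Qed.

Lemma zgr_closed : group_closed (zgr x).
Proof.
split=> [|g h /asboolP[m ->] /asboolP[n ->]]; apply/asboolP; first by exists 0%R.
by exists (m - n)%R; rewrite zexpgD zexpgN.
Qed.
End IntegerPowers.

(** * The semigroup on the union of the groups *)

Section UnionOfGroups.
Local Open Scope group_scope.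
Variables (X : finType) (r : solution X) (d : exponent_multiple r).
Implicit Types u v w : Lambda r.

Lemma inG_inj u : injective (@inG X r d u).
Proof. exact: eq_from_Tagged. Qed.

(** Computed on chosen representatives; [mulGe_frac] shows that the choice does not matter. *)
Definition mulGe (g h : Ge d) : Ge d :=
  let p := generic_quotient.repr (tagged g) in
  let q := generic_quotient.repr (tagged h) in
  inG (fracG d (Smul p.1 q.1) (p.2 + q.2)%R).
Local Notation "g ** h" := (mulGe g h) (at level 40, left associativity).

(** Denominators can be cleared across groups: [c_mulX] turns powers of c_u before an element of S_v
    into powers of c_v after it. *)
Lemma mulGe_frac u v (a : Su u) (b : Su v) (n m : int) :
  inG (fracG d a n) ** inG (fracG d b m) = inG (fracG d (Smul a b) (n + m)%R).
Proof.
have /fracP[k [l [h1 h2]]] := fracK (fracG d a n).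
have /fracP[k' [l' [h3 h4]]] := fracK (fracG d b m).
congr inG; apply/fracP; exists (k + k')%N, (l + l')%N; split.
  have E (y : Su u) (z : Su v) (i j : nat) : val (Smul y z) * cM d v ^+ (i + j) =
      (val y * cM d u ^+ i) * (val z * cM d v ^+ j).
    by rewrite /= expgnDr -!mulgA [in RHS](mulgA (cM d u ^+ i)) (c_mulX _ _ _ (valP z)) !mulgA.
  by rewrite !E h1 h3.
by rewrite !PoszD addrACA h2 h4 addrACA.
Qed.

Lemma GeE (g : Ge d) : exists u (a : Su u) n, g = inG (fracG d a n).
Proof. by case: g => u g; case: (fracE g) => a [n ->]; exists u, a, n. Qed.

Lemma mulGeA : associative mulGe.
Proof.
move=> g h k.
have [u [a [n ->]]] := GeE g; have [v [b [m ->]]] := GeE h; have [w [e [l ->]]] := GeE k.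
rewrite !mulGe_frac addrA; congr (inG (fracG d _ _)).
by apply: val_inj; rewrite /= mulgA.
Qed.

Lemma mulGe_cancel : left_cancellative mulGe.
Proof.
move=> g h k e; have := congr1 tag e; move: e.
have [u [a [n ->]]] := GeE g; have [v [b [m ->]]] := GeE h; have [w [e [l ->]]] := GeE k.
rewrite !mulGe_frac => /[swap] /= vw; case: w / vw e => e.
move=> /inG_inj/fracP[i [j [/= h1 h2]]]; congr inG; apply/fracP.
exists i, j; split; last by lia.
(* The factor [val a] is cancelled in S, in front of two elements of S_v that carry the cleared
   denominators. *)
apply: (@Su_mulI _ _ (val v) (val v) (val a)); last by rewrite !mulgA.
  by rewrite c_centralX ?(valP b) // in_Su_mull ?(valP b).
by rewrite c_centralX ?(valP e) // in_Su_mull ?(valP e).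
Qed.

Lemma mulGe_in u (g h : G d u) : inG g ** inG h = inG (g * h).
Proof.
case: (fracE g) (fracE h) => [a [n ->]] [b [m ->]].
rewrite mulGe_frac frac_mul; congr (inG (fracG d _ _)).
exact: val_inj.
Qed.

(** The identity of G_u is c_u o c_u^-1; moved past [b], its c_u becomes c_v, which the exponent -1
    absorbs. *)
Lemma mul1Ge u g : inG (1 : G d u) ** g = g.
Proof.
have [v [b [m ->]]] := GeE g; rewrite [1]/(fracG d (c d u) (-1)%R) mulGe_frac.
congr inG; apply/fracP; exists 0%N, 1%N; split; last by lia.
by rewrite mulg1 /= (c_mul _ _ (valP b)).
Qed.

(** An ideal containing [a] contains a e_v, so it meets every group G_v and hence contains it. *)
Lemma mulGe_simple : simple_semigroup mulGe.
Proof.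
move=> I I_ideal [a Ia] [v g].
have {a Ia}[b Ib] : exists b : G d v, I (inG b).
  have [] := I_ideal a (inG (1 : G d v)) Ia.
  by exists (tagged (a ** inG (1 : G d v))).
change (I (inG g)); rewrite -(mulKVg b g) -mulGe_in.
by case: (I_ideal (inG b) (inG (b^-1 * g)) Ib).
Qed.

(** The inverse sends [(h, v)] to h e_v: as e_u is a left identity, g e_u e_v = g e_v, which is g
    for g in G_v. *)
Lemma Ge_rees u : exists f : Ge d -> rees (G d u) #|{: Lambda r}|,
  semigroup_iso mulGe (@rees_mul (G d u) #|{: Lambda r}|) f.
Proof.
(* The tag of [g ** inG 1] computes to [u] whatever the tag of [g], so the first entry is well
   typed. *)
pose f (g : Ge d) : rees (G d u) #|{: Lambda r}| :=
  ((tagged (g ** inG (1 : G d u)) : G d u), ord0, enum_rank (tag g)).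
have fE g : inG (f g).1.1 = g ** inG (1 : G d u) by [].
pose f' (p : rees (G d u) #|{: Lambda r}|) : Ge d :=
  inG p.1.1 ** inG (1 : G d (enum_val p.2)).
exists f; split; first exists f'.
- move=> g; rewrite /f' fE enum_rankK -mulGeA mul1Ge.
  by case: g => v g; rewrite mulGe_in mulg1.
- move=> [[k i] j]; rewrite (ord1 i) /f' /=; congr (_, _, _); last exact: enum_valK.
  by apply: inG_inj; rewrite fE -mulGeA mul1Ge mulGe_in mulg1.
- move=> g h; congr (_, _, _); apply: inG_inj.
  by rewrite -mulGe_in !fE -!mulGeA mul1Ge.
Qed.

Lemma mulGe_embed : exists iota : structS r -> Ge d,
  [/\ forall u (a : Su u), iota (toS a) = inG (fracG d a 0%R),
      injective iota & {morph iota : a b / a * b >-> a ** b}].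
Proof.
have SuS (m : structS r) : exists g, exists u (a : Su u), m = toS a /\ g = inG (fracG d a 0%R).
  have [u h] := S_in_Su (valP m).
  exists (inG (fracG d (Sub (val m) h : Su u) 0%R)), u, (Sub (val m) h); split=> //.
  exact: val_inj.
have /choice[iota iotaP] := SuS.
have iotaE u (a : Su u) : iota (toS a) = inG (fracG d a 0%R).
  have [v [b [h ->]]] := iotaP (toS a); have {}h : val a = val b by have := congr1 val h.
  (* The index supplied by choice is the given one, as the S_u are disjoint. *)
  have vu : v = u by apply/val_inj/(Su_uniq (valP b)); rewrite -h (valP a).
  by case: u / vu a h => a /val_inj ->.
exists iota; split=> // [a b|a b].
  have [u [m [-> ->]]] := iotaP a; have [v [n [-> ->]]] := iotaP b.
  move=> e; have := congr1 tag e; move: e => /[swap] /= uv; case: v / uv n => n.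
  move=> /inG_inj/fracP[k [l [h1 h2]]]; apply: val_inj => /=.
  (* Both exponents are 0, so the powers of c_u agree; being central they move to the left, where
     cancellation is available. *)
  have kl : k = l by lia.
  move: h1; rewrite kl !c_centralX ?(valP m) ?(valP n) //.
  exact: (Su_mulI (valP m) (valP n)).
have [u [m [-> ->]]] := iotaP a; have [v [n [-> ->]]] := iotaP b.
rewrite mulGe_frac addr0 -iotaE; congr iota; exact: val_inj.
Qed.

(** * The length homomorphism on G_u *)

Section Length.
Variable u : Lambda r.
Implicit Types (g : G d u) (y : fibre u).

Lemma lenG_inv g : lenG g^-1 = (- lenG g)%R.
Proof. by have := lenG_mul g g^-1; rewrite mulgV lenG1; lia. Qed.

Lemma lenG_gen y : lenG (genG d y) = 1%R.
Proof. by rewrite lenG_frac lenM_g mulr0 addr0. Qed.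

Lemma lenG_zexpg g n : lenG (zexpg g n) = (n * lenG g)%R.
Proof. by case: n => n /=; rewrite ?lenG_inv lenGX //; lia. Qed.

(** From |a| + d i = 1 and |a| > 0 follow i = -k and |a| = 1 + kd. The normal form (1 + kd)z of a is
    that of z o c_u^k, so the fraction reduces to z. *)
Lemma lenG_eq1 g : lenG g = 1%R -> exists y, g = genG d y.
Proof.
have d0 := d_gt0 d.
case: (fracE g) => a [i ->]; rewrite lenG_frac => l1.
have [k ik] : exists k : nat, i = (- k%:Z)%R.
  have a0 := lenM_Su (valP a).
  by exists `|i|%N; nia.
have la : lenM (val a) = (1 + k * val d)%N by nia.
(* This is the letter in the normal form of [val a]. Until q(z) = u is known, the central factor has
   to be taken at q(z). *)
pose z := lambda (val a) (val u).
have az : val a = gM r z * cM d (Sub (diag r z) (codom_f _ z)) ^+ k.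
  apply: pi_inj; have /in_SuP[_ ->] := valP a; rewrite la.
  rewrite piM pi_g -/z.
  have -> : cM d (Sub (diag r z) (codom_f _ z)) ^+ k =
            piinv r (gA (diag r z) ^+ (k * val d)).
    apply: pi_inj; rewrite piinvK mulnC expgM.
    elim: k {ik la} => [|k IH]; first by rewrite pi1.
    by rewrite expgS piM IH lambda_c actA_id pi_c -expgS.
  by rewrite piinvK lambda_g actAX actA_g permKV add1n expgS.
have zu : diag r z = val u.
  apply: Su_uniq (valP a); rewrite az.
  have h := in_Su_g r z.
  by rewrite (c_centralX (u := Sub (diag r z) (codom_f _ z)) d k h) in_Su_mull.
exists (Sub z (introT eqP zu)); apply/fracP; exists 0%N, k; split; last by rewrite ik; lia.
rewrite mulg1 az; congr (_ * cM d _ ^+ _); exact: val_inj.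
Qed.
End Length.
End UnionOfGroups.

(** * Splitting G_u over its torsion subgroup *)

Section GroupStructure.
Local Open Scope group_scope.
Variables (X : finType) (r : solution X) (d : exponent_multiple r) (u : Lambda r).
Variable x : fibre u.
Implicit Types g : G d u.
Local Notation y := (genG d x).

(** As x_u has length 1, dividing by its |g|-th power leaves length 0, which characterises
    torsion. *)
Lemma torsion_decomp g : torsion (G d u) (g * (zexpg y (lenG g))^-1).
Proof. by apply/torsionP; rewrite lenG_mul lenG_inv lenG_zexpg lenG_gen mulr1 subrr. Qed.

(** If g has length 0, then g x_u has length 1 and is therefore a generator. *)
Lemma torsion_gen g :
  g \in torsion (G d u) <-> exists z : fibre u, g = genG d z * y^-1.
Proof.
split=> [/torsionP g0|[z ->]].
  have [|z zE] := @lenG_eq1 X r d u (g * y); first by rewrite lenG_mul g0 lenG_gen.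
  by exists z; rewrite -zE mulgK.
by apply/torsionP; rewrite lenG_mul lenG_inv !lenG_gen subrr.
Qed.

Lemma T_finite : exists s : seq (T d u), forall t, t \in s.
Proof.
have Tz (z : fibre u) : torsion (G d u) (genG d z * y^-1).
  by apply/torsion_gen; exists z.
exists (codom (fun z => Sub (genG d z * y^-1) (Tz z) : T d u)) => t.
have /torsion_gen[z tz] := valP t; apply/codomP; exists z; exact: val_inj.
Qed.

Lemma torsion_sdprod : internal_sdprod (torsion (G d u)) (zgr y).
Proof.
split; first by split; [exact: torsion_closed|exact: zgr_closed].
- move=> g n /torsionP n0; apply/torsionP.
  by rewrite conjgE !lenG_mul lenG_inv n0 add0r addNr.
- move=> g /torsionP g0 /asboolP[n gE]; move: g0.
  by rewrite gE lenG_zexpg lenG_gen mulr1 => ->.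
- move=> g; exists (g * (zexpg y (lenG g))^-1), (zexpg y (lenG g)); split.
  + exact: torsion_decomp.
  + by apply/asboolP; exists (lenG g).
  + by rewrite mulgVK.
Qed.

Lemma val_zaut n (t : T d u) :
  val (zaut (sigma d x) (sigma_inv d x) n t) = zexpg y n * val t * (zexpg y n)^-1.
Proof.
have iterE (g : G d u) k : val (iter k (conjT g) t) = g ^+ k * val t * (g ^+ k)^-1.
  elim: k => [|k IH]; first by rewrite invg1 mulg1 mul1g.
  by rewrite iterS /= IH expgS invMg !mulgA.
by case: n => k; rewrite /zaut iterE ?expVgn.
Qed.

(** The length recovers the exponent, and the inverse is g |-> (g x_u^{-|g|}, |g|). By [val_zaut],
    the twist is conjugation by x_u^n. *)
Lemma torsion_sdprodZ : semigroup_iso (sdprodZ_mul (sigma d x) (sigma_inv d x)) *%g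
  (fun p : T d u * int => val p.1 * zexpg y p.2).
Proof.
split.
  exists (fun g => (Sub _ (torsion_decomp g) : T d u, lenG g)) => [[t n]|g].
    have l : lenG (val t * zexpg y n) = n.
      by have /torsionP t0 := valP t; rewrite lenG_mul t0 lenG_zexpg lenG_gen mulr1 add0r.
    by congr (_, _); [apply: val_inj; rewrite /= l mulgK | exact: l].
  by rewrite /= mulgVK.
move=> [t n] [t' n']; rewrite /sdprodZ_mul /= val_zaut zexpgD.
by rewrite !mulgA mulgVK.
Qed.
End GroupStructure.

(** * Generators of S inside the union, and assembly of the results *)

(** Each z in X is (z x_u^-1) x_u with u = q(z) and a torsion first factor. Conversely t x_u has
    length 1, so it is the image of some z in X. *)
Lemma iota_image (X : finType) (r : solution X) (d : exponent_multiple r)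
    (x : forall u : Lambda r, fibre u) (iota : structS r -> Ge d) :
  (forall u (a : Su u), iota (toS a) = inG (fracG d a 0)) ->
  {morph iota : a b / (a * b)%g >-> mulGe a b} ->
  forall g : Ge d, (exists a, g = iota a) <->
    generated_subsemigroup (@mulGe X r d) (fun h => exists (u : Lambda r) (t : T d u),
      h = inG (val t * genG d (x u))%g) g.
Proof.
move=> iotaE iotaM g; split=> [[m ->{g}]|].
  have gen (z : X) (h : in_S (gM r z)) : generated_subsemigroup (@mulGe X r d)
      (fun h => exists (u : Lambda r) (t : T d u), h = inG (val t * genG d (x u))%g)
      (iota (Sub (gM r z) h)).
    pose u : Lambda r := Sub (diag r z) (codom_f _ z).
    pose y : fibre u := Sub z (introT eqP (erefl (diag r z))).
    have ty : torsion (G d u) (genG d y * (genG d (x u))^-1)%g by apply/torsion_gen; exists y.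
    apply: Gen_base; exists u, (Sub _ ty).
    rewrite /= mulgVK -iotaE; congr iota; exact: val_inj.
  case: m => m; rewrite -(mclK m); elim: (generic_quotient.repr m) => [|z w IH] h.
    by case/eqP: (h).
  have hz : in_S (gM r z) by case/in_SuP: (in_Su_g r z).
  (* S lacks the identity, so a word whose tail is trivial is treated apart as a single
     generator. *)
  have [w0|hw] := eqVneq (mcl w : structM r) 1%g.
    have := gen z hz; congr (generated_subsemigroup _ _ (iota _)); apply: val_inj.
    by rewrite /= -cat1s -mclM w0 mulg1.
  rewrite (_ : exist _ _ _ = (Sub (gM r z) hz * Sub (mcl w) hw)%g :> structS r).
    by rewrite iotaM; apply: Gen_op; [exact: gen|exact: IH].
  by apply: val_inj; rewrite /= mclM.
elim=> {g} [g [u [t ->]]|g h _ [a ->] _ [b ->]]; last by exists (a * b)%g.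
have [|z ->] := @lenG_eq1 X r d u (val t * genG d (x u))%g.
  by have /torsionP t0 := valP t; rewrite lenG_mul t0 lenG_gen.
by exists (toS (Defs.genS z)); rewrite iotaE.
Qed.
Theorem theorem3p8 (K : fieldType) (X : finType) (r : solution X)
    (d : exponent_multiple r) (x : forall u : Lambda r, fibre u)
    (x_generates : forall (u : Lambda r) (g : G d u), exists n : int,
       (g * (zexpg (genG d (x u)) n)^-1)%g \in torsion (G d u)) :
  exists (op : Ge d -> Ge d -> Ge d) (iota : structS r -> Ge d),
  (* G^e is a left cancellative simple semigroup *)
  [/\ forall (u v : Lambda r) (a : Su u) (b : Su v) (n m : int),
        op (inG (fracG d a n)) (inG (fracG d b m)) = inG (fracG d (Smul a b) (n + m)),
      associative op,
      left_cancellative op &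
      simple_semigroup op] /\
  (* the embedding of S, and generators of its image *)
  [/\ forall (u : Lambda r) (a : Su u), iota (toS a) = inG (fracG d a 0),
      injective iota,
      {morph iota : a b / (a * b)%g >-> op a b} &
      forall g : Ge d,
        (exists a, g = iota a) <->
        generated_subsemigroup op
          (fun h => exists (u : Lambda r) (t : T d u),
             h = inG (val t * genG d (x u))%g) g] /\
  (* structure of the groups G_u *)
  (forall u : Lambda r,
     [/\ internal_sdprod (torsion (G d u)) (zgr (genG d (x u))),
         semigroup_iso (sdprodZ_mul (sigma d (x u)) (sigma_inv d (x u))) *%g
           (fun p : T d u * int => (val p.1 * zexpg (genG d (x u)) p.2)%g),
         exists f : Ge d -> rees (G d u) #|{: Lambda r}|,
           semigroup_iso op (@rees_mul (G d u) #|{: Lambda r}|) f,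
         exists s : seq (T d u), forall t, t \in s &
         forall g : G d u, g \in torsion (G d u) <->
           exists y : fibre u, g = (genG d y * (genG d (x u))^-1)%g]) /\
  (* the Lambda-graded ring, direct sum of the K[G_u] *)
  [/\ nonunital_algebra (salg_mul op : {malg K[Ge d]} -> _ -> _),
      graded_sum (fun _ v : Lambda r => v) (salg_mul op : {malg K[Ge d]} -> _ -> _)
        (fun u (f : {malg K[G d u]}) => salg_map (@inG X r d u) f) &
      forall (u : Lambda r) (f g : {malg K[G d u]}),
        salg_map (@inG X r d u) (salg_mul *%g f g) =
        salg_mul op (salg_map (@inG X r d u) f) (salg_map (@inG X r d u) g)] /\
  (* K[S] is a subalgebra *)
  [/\ linear (salg_map iota : {malg K[structS r]} -> {malg K[Ge d]}),
      injective (salg_map iota : {malg K[structS r]} -> {malg K[Ge d]}) &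
      forall f g : {malg K[structS r]},
        salg_map iota (salg_mul *%g f g) = salg_mul op (salg_map iota f) (salg_map iota g)] /\
  (* K[G_u] is the skew Laurent polynomial algebra K[T(G_u)][t^{+-1}; sigma_u] *)
  (forall u : Lambda r,
     exists Phi : {malg {malg K[T d u]}[int]} -> {malg K[G d u]},
     [/\ bijective Phi,
         {morph Phi : f g / f + g},
         forall (k : K) f, Phi (skew_scale k f) = k *: Phi f,
         forall f g,
           Phi (skew_mul (salg_mul *%g) (salg_map (sigma d (x u)))
                  (salg_map (sigma_inv d (x u))) f g) =
           salg_mul *%g (Phi f) (Phi g) &
         forall (a : {malg K[T d u]}) (n : int),
           Phi << a *g n >> =
           salg_mul *%g (salg_map val a) << 1 *g zexpg (genG d (x u)) n >>]).
Proof.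
have [iota [iotaE iota_inj iotaM]] := mulGe_embed d.
exists (@mulGe X r d), iota.
split; first by split; [exact: mulGe_frac|exact: mulGeA|exact: mulGe_cancel|exact: mulGe_simple].
split; first by split=> //; exact: iota_image.
split.
  move=> u; split.
  - exact: torsion_sdprod.
  - exact: torsion_sdprodZ.
  - exact: Ge_rees.
  - exact: T_finite (x u).
  - exact: torsion_gen.
split.
  split; first exact: salg_nonunital (@mulGeA X r d).
  (* The tag of a product is that of its right factor by computation, as the grading requires. *)
  - exact: salg_graded_sum.
  - by move=> u; apply: salg_map_mul => g h; rewrite mulGe_in.
split.
  split; first exact: salg_map_linear.
  - exact: salg_map_inj.
  - exact: salg_map_mul.
by move=> u; exact: (skew_laurent_group K (torsion_sdprodZ d (x u))).
Qed.
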